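(* Let $G$ be a compact topological group, let $\rho:G\to \mathrm{GL}_n(\mathbb R)$ be a continuous representation, and let $\mathcal F\subseteq\mathcal C(\mathbb R)$ be a family of functions, not consisting only of affine functions, such that $\rho$ is admissible for $\mathcal F$, i.e. $\tilde f(\rho(g)v)=\rho(g)\tilde f(v)$ for all $f\in\mathcal F$, $g\in G$, $v\in\mathbb R^n$. Then $\rho$ is isomorphic either to a representation by permutation matrices or to a representation by signed permutation matrices. Consequently, after replacing $\rho$ by an isomorphic representation $\rho'$, the family of activations can be chosen to be the set of all continuous functions (in the permutation case), respectively the set of all odd continuous functions (in the signed permutation case); that is, $\tilde f$ commutes with $\rho'(g)$ for all $g\in G$ and all such $f$.
   Context: $\mathcal C(\mathbb R)$ is the set of continuous functions $\mathbb R\to\mathbb R$; an affine function is one of the form $x\mapsto ax+c$. For $f\in\mathcal C(\mathbb R)$, $\tilde f:\mathbb R^n\to\mathbb R^n$ is the point-wise map $\tilde f(x_1,\dots,x_n)=(f(x_1),\dots,f(x_n))$. A permutation matrix (resp. signed permutation matrix) is a matrix with exactly one non-zero entry in each row and column, all non-zero entries being equal to $1$ (resp. to $\pm1$). Two representations $\rho,\rho':G\to\mathrm{GL}_n(\mathbb R)$ are isomorphic if there is $B\in \mathrm{GL}_n(\mathbb R)$ with $\rho'(g)=B\rho(g)B^{-1}$ for all $g\in G$. *)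

(* Defs.v *)
From HB Require Import structures.
From mathcomp Require Import all_boot all_order all_algebra perm.
From mathcomp Require Import all_classical all_reals all_analysis.

Set Implicit Arguments.
Unset Strict Implicit.
Unset Printing Implicit Defensive.

Import Order.TTheory GRing.Theory Num.Theory.
Import numFieldNormedType.Exports.

Local Open Scope classical_set_scope.
Local Open Scope ring_scope.

(* No separation axiom is assumed: topological groups need not be Hausdorff. *)
HB.mixin Record isTopologicalGroup G & Topological G & Group G := {
  topgrp_mul_continuous : continuous (fun x : G * G => (x.1 * x.2)%g : G) ;
  topgrp_inv_continuous : continuous (fun x : G => (x^-1)%g : G)
}.

#[short(type="topologicalGroupType")]
HB.structure Definition TopologicalGroup :=
  {G of Topological G & Group G & isTopologicalGroup G}.

(* GL_n(R) is rendered as the invertible elements of 'M[R]_n; since it carries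
   the subspace topology, continuity into GL_n(R) is continuity into 'M[R]_n. *)
Record continuous_rep (R : realType) (G : topologicalGroupType) (n : nat)
    (rho : G -> 'M[R]_n) : Prop := ContinuousRep {
  rep_unitmx : forall g, rho g \in unitmx ;
  rep_one : rho 1%g = 1%:M ;
  rep_mul : forall g h, rho (g * h)%g = rho g *m rho h ;
  rep_continuous : continuous rho
}.

Definition rep_isomorphic (R : realType) (G : topologicalGroupType) (n : nat)
    (rho rho' : G -> 'M[R]_n) : Prop :=
  exists2 B : 'M[R]_n, B \in unitmx &
    forall g, rho' g = B *m rho g *m invmx B.

(* [map_mx f] is the point-wise map v |-> (f v_1, ..., f v_n). *)
Definition admissible (R : realType) (G : topologicalGroupType) (n : nat)
    (rho : G -> 'M[R]_n) (F : set (R -> R)) : Prop :=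
  forall f, F f -> forall (g : G) (v : 'cV[R]_n),
    map_mx f (rho g *m v) = rho g *m map_mx f v.

Definition affine_functions (R : realType) : set (R -> R) :=
  [set f | exists a c : R, forall x, f x = a * x + c].

Definition continuous_functions (R : realType) : set (R -> R) :=
  [set f | continuous f].

Definition odd_continuous_functions (R : realType) : set (R -> R) :=
  [set f | continuous f /\ forall x, f (- x) = - f x].

Arguments affine_functions R : clear implicits.
Arguments continuous_functions R : clear implicits.
Arguments odd_continuous_functions R : clear implicits.

Definition one_nonzero_entry (R : realType) (n : nat) (A : 'M[R]_n) : Prop :=
  (forall i, exists! j, A i j != 0) /\ (forall j, exists! i, A i j != 0).

Definition signed_perm_mx (R : realType) (n : nat) (A : 'M[R]_n) : Prop :=
  one_nonzero_entry A /\
  forall i j, A i j != 0 -> A i j = 1 \/ A i j = -1.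

(* The unsigned analogue of [signed_perm_mx] is the library's [is_perm_mx]. *)
Lemma is_perm_mx_entriesP (R : realType) (n : nat) (A : 'M[R]_n) :
  is_perm_mx A <->
  one_nonzero_entry A /\ forall i j, A i j != 0 -> A i j = 1.
Proof.
have pmE (s : 'S_n) i j : (perm_mx s : 'M[R]_n) i j = (s i == j)%:R.
  by rewrite !mxE.
split.
  case/is_perm_mxP => s ->; split; last first.
    by move=> i j; rewrite pmE; case: (s i =P j) => // _; rewrite /= eqxx.
  split=> [i|j].
    exists (s i); split; first by rewrite pmE eqxx oner_neq0.
    by move=> j; rewrite pmE; case: (s i =P j) => // _; rewrite /= eqxx.
  exists ((s^-1)%g j); split; first by rewrite pmE permKV eqxx oner_neq0.
  move=> i; rewrite pmE; case: (s i =P j) => [<- _|_]; last by rewrite /= eqxx.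
  by rewrite permK.
case=> -[rowA colA] A1.
have [s sP] := choice rowA.
have s_inj : injective s.
  move=> i i' ss; have [k [_ kP]] := colA (s i).
  by rewrite -(kP i (sP i).1) -(kP i'); rewrite // ss; exact: (sP i').1.
apply/is_perm_mxP; exists (perm s_inj); apply/matrixP => i j.
rewrite pmE permE; case: (s i =P j) => [<-|sij]; first exact: (A1 _ _ (sP i).1).
by case: (eqVneq (A i j) 0) => // /(sP i).2.
Qed.

(* Main.v *)
Require Import Defs.
From HB Require Import structures.
From mathcomp Require Import all_boot all_order all_algebra.
From mathcomp Require Import all_classical all_reals all_analysis.

Set Implicit Arguments.
Unset Strict Implicit.
Unset Printing Implicit Defensive.

Import Order.TTheory GRing.Theory Num.Theory.
Import numFieldNormedType.Exports.

Local Open Scope classical_set_scope.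
Local Open Scope ring_scope.

(** A row [a] of an admissible matrix satisfies
    [f (sum a_j x_j) = sum a_j (f x_j)].  After subtracting [f 0], two non-zero
    coefficients would make [f] additive, hence linear by continuity.  So for
    non-affine [f] every matrix of the representation is monomial.  The suprema
    [w i] of the absolute values in the [i]-th row over the compact group
    satisfy [w i = `|a_ij| * w j] whenever [a_ij] is a non-zero entry, so
    conjugating by [diag (1 / w i)] makes all non-zero entries equal to [1] or
    [-1].  Signed permutation matrices commute with all odd functions; as
    permutation matrices are among them, the second alternative always
    holds. *)

(** The defect [g y = f y - f 1 * y] is additive and vanishes at [1], hence at every rational. Its
    zero set is closed, so the open complement, if non-empty, would contain a rational. *)
Lemma additive_continuous_linear (R : realType) (f : R -> R) :
  {morph f : x y / x + y} -> continuous f -> forall x, f x = f 1 * x.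
Proof.
move=> fD fC x; pose g y := f y - f 1 * y.
have gB : {morph g : y z / y - z}.
  have f0 : f 0 = 0 by apply: (addrI (f 0)); rewrite -fD !addr0.
  have fN y : f (- y) = - f y.
    by apply/eqP; rewrite -addr_eq0 -fD addNr f0.
  by move=> y z; rewrite /g fD fN mulrBr !opprB addrACA [RHS]addrACA (addrC (- f z)).
pose gA := GRing.isZmodMorphism.Build R R g gB.
pose gh : {additive R -> R} := HB.pack g gA.
have gMz y (m : int) : g (y *~ m) = g y *~ m by exact: (raddfMz gh).
have gC : continuous g.
  move=> y; apply: cvgB; first exact: fC.
  by apply: cvgM; [exact: cvg_cst|exact: cvg_id].
(* Multiplying by the denominator of [q] turns the value into an integer multiple of [g 1], which is
   [0]. *)
have g_rat q : g (ratr q) = 0.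
  have d0 : (denq q)%:~R != 0 :> R by rewrite intr_eq0 denq_neq0.
  apply/eqP; rewrite -(mulIr_eq0 _ (mulIf d0)) mulrzr -gMz -mulrzr.
  by rewrite /ratr mulfVK // gMz /g mulr1 subrr mul0rz.
have clZ : closed (g @^-1` [set 0]).
  by apply: closed_comp => [y _|]; [exact: gC|exact: closed_eq].
apply/eqP; rewrite -subr_eq0; apply/eqP; rewrite -/(g x).
suff : (g @^-1` [set 0]) x by [].
apply: contrapT => gx.
have [y [/= gy [q _ qy]]] : (~` (g @^-1` [set 0]) `&` range (@ratr R)) !=set0.
  by apply: dense_rat; [exists x|exact: closed_openC].
by apply: gy; rewrite /= -qy g_rat.
Qed.

Lemma commuting_row_unique (R : realType) (n : nat) (A : 'M[R]_n) (f : R -> R) :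
  continuous f -> ~ affine_functions R f ->
  (forall v : 'cV[R]_n, map_mx f (A *m v) = A *m map_mx f v) ->
  forall i j k, A i j != 0 -> A i k != 0 -> j = k.
Proof.
move=> fC fnA fA i j k aj ak; apply/esym/eqP; apply: contrapT => /negP jk.
pose g x := f x - f 0.
have rowf (v : 'I_n -> R) : f (\sum_l A i l * v l) = \sum_l A i l * f (v l).
  have -> : \sum_l A i l * f (v l) = (A *m map_mx f (\col_l v l)) i ord0.
    by rewrite mxE; apply: eq_bigr => l _; rewrite !mxE.
  by rewrite -fA !mxE; congr f; apply: eq_bigr => l _; rewrite !mxE.
(* The row identity at the zero vector reads [f 0 = \sum_l A i l * f 0], so the constant [f 0] can
   be subtracted on both sides. *)
have rowg (v : 'I_n -> R) : g (\sum_l A i l * v l) = \sum_l A i l * g (v l).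
  have f0 := rowf (fun=> 0).
  rewrite big1 in f0; last by move=> l _; rewrite mulr0.
  rewrite /g rowf; under [RHS]eq_bigr do rewrite mulrBr.
  by rewrite sumrB -f0.
have g0 : g 0 = 0 by rewrite /g subrr.
(* Needed for [h = id] and for [h = g]: these are the two sides of the row identity at a vector
   supported on [j] and [k]. *)
have sum2 (h : R -> R) x y : h 0 = 0 ->
    \sum_l A i l * h (if l == j then x else if l == k then y else 0)
    = A i j * h x + A i k * h y.
  move=> h0; rewrite (bigD1 j) //= eqxx; congr (_ + _).
  rewrite (bigD1 k) //= (negbTE jk) eqxx big1 ?addr0 //.
  by move=> l /andP[/negbTE -> /negbTE ->]; rewrite h0 mulr0.
have g2 x y : g (A i j * x + A i k * y) = A i j * g x + A i k * g y.
  by rewrite -(sum2 id) // rowg sum2.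
have gD : {morph g : x y / x + y}.
  move=> x y.
  (* Setting one variable of [g2] to [0] shows that [g] absorbs each coefficient; rescaling both
     variables then gives additivity. *)
  have gj z : A i j * g (z / A i j) = g z.
    by have := g2 (z / A i j) 0; rewrite g0 !mulr0 !addr0 mulrC mulfVK.
  have gk z : A i k * g (z / A i k) = g z.
    by have := g2 0 (z / A i k); rewrite g0 !mulr0 !add0r mulrC mulfVK.
  by have := g2 (x / A i j) (y / A i k); rewrite gj gk mulrC mulfVK // mulrC mulfVK.
have gC : continuous g.
  by move=> x; apply: cvgB; [exact: fC|exact: cvg_cst].
apply: fnA; exists (g 1), (f 0) => x.
by rewrite -(additive_continuous_linear gD gC) /g subrK.
Qed.

(** Invertibility rules out zero rows and columns. If rows [i] and [i'] both meet column [j], the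
    diagonal entry [(i, i)] of [A *m B = 1%:M] forces [B j i != 0]; then entry [(i', i)] equals
    [A i' j * B j i], which is non-zero, so [i = i']. *)
Lemma one_nonzero_entry_unitmx (R : realType) (n : nat) (A : 'M[R]_n) :
  A \in unitmx -> (forall i j k, A i j != 0 -> A i k != 0 -> j = k) ->
  one_nonzero_entry A.
Proof.
move=> uA uniqA.
have AV := mulmxV uA; have VA := mulVmx uA; set B := invmx A in AV VA.
have nz (M N : 'M[R]_n) i : M *m N = 1%:M -> exists2 j, M i j != 0 & N j i != 0.
  move=> /matrixP/(_ i i); rewrite !mxE eqxx => MN; apply: contrapT => no.
  move: MN; rewrite big1 => [/esym/eqP|j _]; first by rewrite oner_eq0.
  apply/eqP; apply: contrapT => /negP; rewrite mulf_eq0 negb_or => /andP[Mj Nj].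
  by apply: no; exists j.
have colA i i' j : A i j != 0 -> A i' j != 0 -> i = i'.
  move=> aij ai'j; have [k aik bki] := nz _ _ i AV.
  have /matrixP/(_ i' i) := AV; rewrite !mxE => H; apply/esym/eqP.
  apply: contrapT => /negP/negbTE ne; move: H; rewrite ne (bigD1 j) //=.
  rewrite big1 ?addr0 => [/eqP|l lj].
    by rewrite mulf_eq0 (negbTE ai'j) (uniqA i j k) // (negbTE bki).
  case: (eqVneq (A i' l) 0) => [->|/(uniqA i' _ _ ai'j) jl]; first by rewrite mul0r.
  by rewrite jl eqxx in lj.
split=> [i|j].
  have [j aij _] := nz _ _ i AV; exists j; split=> // k; exact: uniqA.
have [i _ aij] := nz _ _ j VA; exists i; split=> // k; exact: colA.
Qed.

Lemma signed_perm_mx_odd (R : realType) (n : nat) (A : 'M[R]_n) (f : R -> R)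
    (v : 'cV[R]_n) :
  signed_perm_mx A -> (forall x, f (- x) = - f x) ->
  map_mx f (A *m v) = A *m map_mx f v.
Proof.
move=> [[rowA _] sA] fN; apply/matrixP => i z; rewrite !mxE.
have [j [aij uj]] := rowA i.
have sumE (w : 'I_n -> R) : \sum_l A i l * w l = A i j * w j.
  rewrite (bigD1 j) //= big1 ?addr0 // => l lj.
  case: (eqVneq (A i l) 0) => [->|/uj jl]; first by rewrite mul0r.
  by rewrite jl eqxx in lj.
by rewrite !sumE mxE; have [->|->] := sA i j aij; rewrite ?mul1r ?mulN1r.
Qed.

Lemma continuous_mx (T R : topologicalType) (m n : nat) (A : T -> 'M[R]_(m, n)) :
  (forall i j, continuous (fun t => A t i j)) -> continuous A.
Proof.
move=> AC t U [P PA PU]; apply: (@filterS _ _ _ [set s | forall i j, P i j (A s i j)]).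
  by move=> s; exact: PU.
apply: filter_forall => i; apply: filter_forall => j.
exact: (AC i j t _ (PA i j)).
Qed.

Lemma continuous_rep_bounded (R : realType) (G : topologicalGroupType) (n : nat)
    (rho : G -> 'M[R]_n) :
  compact [set: G] -> continuous rho ->
  exists M, forall g i j, `|rho g i j| <= M.
Proof.
move=> cG rC.
have bnd i j : exists M, forall g, `|rho g i j| <= M.
  have c : compact ((fun g => rho g i j) @` [set: G]).
    apply: continuous_compact => //; apply: continuous_subspaceT => g.
    exact: (continuous_comp (rC g) (@coord_continuous _ _ _ i j _)).
  have [M [_ HM]] := compact_bounded c.
  (* [HM] bounds the entries only by reals strictly above [M]. *)
  by exists (M + 1) => g; apply: HM; [rewrite ltrDl|exists g].
have [M HM] := choice (fun p : 'I_n * 'I_n => bnd p.1 p.2).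
(* Each [M p] bounds an absolute value and so is non-negative; the sum therefore dominates every
   [M p]. *)
exists (\sum_p M p) => g i j; rewrite (bigD1 (i, j)) //=.
apply: le_trans (HM (i, j) g) _; rewrite lerDl sumr_ge0 // => p _.
exact: le_trans (HM p g).
Qed.

Theorem theorem2 (R : realType) (G : topologicalGroupType) (n : nat)
    (rho : G -> 'M[R]_n) (F : set (R -> R)) :
  compact [set: G] ->
  continuous_rep rho ->
  F `<=` continuous_functions R ->
  ~ (F `<=` affine_functions R) ->
  admissible rho F ->
  exists rho' : G -> 'M[R]_n,
    [/\ continuous_rep rho',
        rep_isomorphic rho rho' &
        ((forall g, is_perm_mx (rho' g)) /\
           admissible rho' (continuous_functions R)) \/
        ((forall g, signed_perm_mx (rho' g)) /\
           admissible rho' (odd_continuous_functions R))].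
Proof.
move=> cG [rU r1 rM rC] FC FnA rF.
have [f Ff fnA] : exists2 f, F f & ~ affine_functions R f.
  apply: contrapT => no; apply: FnA => f Ff; apply: contrapT => fnA.
  by apply: no; exists f.
have rowU g := commuting_row_unique (FC f Ff) fnA (rF f Ff g).
have mono g := one_nonzero_entry_unitmx (rU g) (rowU g).
have [M HM] := continuous_rep_bounded cG rC.
pose S i := [set x | exists g k, x = `|rho g i k|].
pose w i := sup (S i).
have Sub i : has_ubound (S i) by exists M => _ [g [k ->]].
have w_ge i g k : `|rho g i k| <= w i by apply: ub_le_sup => //; exists g, k.
have w_gt0 i : 0 < w i.
  apply: lt_le_trans (w_ge i 1%g i); by rewrite r1 mxE eqxx normr1.
have w0 i : w i != 0 by rewrite gt_eqF.
have rowmul g (N : 'M[R]_n) i j k : rho g i j != 0 ->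
    (rho g *m N) i k = rho g i j * N j k.
  move=> aij; rewrite mxE (bigD1 j) //= big1 ?addr0 // => l lj.
  case: (eqVneq (rho g i l) 0) => [->|/(rowU g i _ _ aij) jl];
    first by rewrite mul0r.
  by rewrite jl eqxx in lj.
(* Row [i] of [rho (g * h)] is [rho g i j] times row [j] of [rho h]. As [h] runs over the group so
   does [g * h], and the two suprema are compared in both directions. *)
have wE g i j : rho g i j != 0 -> w i = `|rho g i j| * w j.
  move=> aij; apply/eqP; rewrite eq_le; apply/andP; split.
    apply: ge_sup; first by exists `|rho 1%g i i|, 1%g, i.
    move=> _ [h [k ->]].
    have -> : h = (g * (g^-1 * h))%g by rewrite mulgA mulgV mul1g.
    by rewrite rM (rowmul _ _ _ _ _ aij) normrM ler_wpM2l.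
  rewrite mulrC -ler_pdivlMr ?normr_gt0 //.
  apply: ge_sup; first by exists `|rho 1%g j j|, 1%g, j.
  move=> _ [h [k ->]]; rewrite ler_pdivlMr ?normr_gt0 // mulrC -normrM.
  by rewrite -(rowmul _ _ _ _ _ aij) -rM.
pose D : 'M[R]_n := diag_mx (\row_i (w i)^-1).
pose E : 'M[R]_n := diag_mx (\row_i w i).
have DE : D *m E = 1%:M.
  apply/matrixP => i j; rewrite mul_diag_mx !mxE.
  by case: eqP => [->|_]; rewrite ?mulr1n ?mulr0n ?mulr0 // mulVf.
have [uD _] := mulmx1_unit DE.
have DV : invmx D = E by rewrite -[LHS]mulmx1 -DE mulKmx.
pose rho' g := D *m rho g *m invmx D.
have rE g i j : rho' g i j = (w i)^-1 * rho g i j * w j.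
  by rewrite /rho' DV mul_mx_diag mul_diag_mx !mxE.
have rE0 g i j : (rho' g i j != 0) = (rho g i j != 0).
  by rewrite rE !mulf_eq0 invr_eq0 !(negbTE (w0 _)) orbF.
have sg g : signed_perm_mx (rho' g).
  split.
    have [rowA colA] := mono g; split=> [i|j].
      have [j [aij uj]] := rowA i; exists j.
      by split=> [|k]; rewrite rE0 //; exact: uj.
    have [i [aij ui]] := colA j; exists i.
    by split=> [|k]; rewrite rE0 //; exact: ui.
  move=> i j; rewrite rE0 => aij.
  (* The absolute value is [(w i)^-1] times the right-hand side of [wE]. *)
  have : `|rho' g i j| = 1.
    rewrite rE !normrM normfV !(gtr0_norm (w_gt0 _)).
    by rewrite -mulrA -(wE _ _ _ aij) mulVf.
  move=> /eqP; rewrite eqr_norml => /andP[/orP[]/eqP ->]; by [left|right].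
exists rho'; split; last 2 first.
- by exists D.
- by right; split=> // h [_ hN] g v; exact: signed_perm_mx_odd.
split.
- by move=> g; rewrite !unitmx_mul uD rU unitmx_inv.
- by rewrite /rho' r1 mulmx1 mulmxV.
- by move=> g h; rewrite /rho' rM !mulmxA mulmxKV.
- apply: continuous_mx => i j g.
  rewrite (_ : (fun t => _) = fun t => (w i)^-1 * rho t i j * w j);
    last exact/funext.
  apply: cvgM; last exact: cvg_cst.
  apply: cvgM; first exact: cvg_cst.
  exact: (continuous_comp (rC g) (@coord_continuous _ _ _ i j _)).
Qed.
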